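(* Let $a,b,c$ be real numbers with $c\le a<0$ and $b\in\mathbb{R}$, let $k\ge 1$ be an integer, let $R(z)=\sum_{i=1}^k a_{2i}z^{2i}$ with $a_{2i}>0$ for $i=1,\dots,k$, and let $$F(x,y,z)=(y,-x,0)+\big((ax+by)R(z),\,(-bx+cy)R(z),\,-zR(z)\big).$$ Let $\lambda<0$ and $G=\lambda I+F:\mathbb{R}^3\to\mathbb{R}^3$. Then: (i) $G$ is a Hurwitz vector field; (ii) for every $\alpha$ with $\alpha>\max\left\{2,\frac{a+c-1-2k}{2a},\frac{3-a-c}{2}\right\}$ and $\alpha>3$, the function $\rho(x,y,z)=(x^2+y^2+R(z))^{-\alpha}$ is a density function for the system $(\dot x,\dot y,\dot z)=G(x,y,z)$; (iii) the origin is globally asymptotically stable for $(\dot x,\dot y,\dot z)=G(x,y,z)$.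
   Context: $I$ denotes the identity map of $\mathbb{R}^3$. A $C^1$ vector field $G$ on $\mathbb{R}^n$ with $G(0)=0$ is Hurwitz if for every $p\in\mathbb{R}^n$ all eigenvalues of the Jacobian matrix $JG(p)$ have negative real part. A density function of a system $\dot x=G(x)$, where $G:\mathbb{R}^n\to\mathbb{R}^n$ is $C^1$ and $G(0)=0$, is a $C^1$ map $\rho:\mathbb{R}^n\setminus\{0\}\to[0,+\infty)$, integrable outside a ball centered at the origin, such that $[\nabla\cdot(\rho G)](x)>0$ for almost every $x\in\mathbb{R}^n$ (Lebesgue measure), where $\nabla\cdot(\rho G)=\nabla\rho\cdot G+\rho\,(\nabla\cdot G)$. *)

(* Defs.v *)
From mathcomp Require Import all_boot all_order all_algebra.
From mathcomp Require Import complex.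
From mathcomp Require Import all_classical all_reals all_analysis.

Set Implicit Arguments.
Unset Strict Implicit.
Unset Printing Implicit Defensive.
Import Order.TTheory GRing.Theory Num.Theory.
Import numFieldNormedType.Exports.
Local Open Scope classical_set_scope.
Local Open Scope ring_scope.

(* To be used with A open and U finite dimensional, where continuity of every
   directional derivative is continuity of the differential. *)
Definition C1_on (R : realType) (U V : normedModType R) (A : set U)
    (f : U -> V) : Prop :=
  forall x, A x ->
    differentiable f x /\ (forall v, {for x, continuous ('D_v f)}).

Definition C1_field_zero (R : realType) (n : nat)
    (G : 'rV[R]_n -> 'rV[R]_n) : Prop :=
  C1_on [set: 'rV[R]_n] G /\ G 0 = 0.

(* [jacobian G p] acts on row vectors, hence is the transpose of the usual
   Jacobian matrix; the eigenvalues are the same. *)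
Definition hurwitz (R : realType) (n : nat)
    (G : 'rV[R]_n -> 'rV[R]_n) : Prop :=
  C1_field_zero G /\
  forall (p : 'rV[R]_n) (z : R[i]),
    eigenvalue (map_mx (real_complex R) (jacobian G p)) z ->
    complex.Re z < 0.

Definition partial (R : realType) (n : nat) (i : 'I_n)
    (f : 'rV[R]_n -> R) (p : 'rV[R]_n) : R :=
  'D_(delta_mx 0 i) f p.

Definition divergence (R : realType) (n : nat)
    (G : 'rV[R]_n -> 'rV[R]_n) (p : 'rV[R]_n) : R :=
  \sum_(i < n) partial i (fun q => G q 0 i) p.

Definition div_density (R : realType) (n : nat) (rho : 'rV[R]_n -> R)
    (G : 'rV[R]_n -> 'rV[R]_n) (p : 'rV[R]_n) : R :=
  \sum_(i < n) partial i rho p * G p 0 i + rho p * divergence G p.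

(* The library norm on row vectors is the sup norm. *)
Definition euclid (R : realType) (n : nat) (p : 'rV[R]_n) : R :=
  Num.sqrt (\sum_(i < n) p 0 i ^+ 2).

Definition vec3 (R : realType) (x y z : R) : 'rV[R]_3 :=
  \row_(i < 3) [:: x; y; z]`_i.

Definition of_triple (R : realType) (p : R * R * R) : 'rV[R]_3 :=
  vec3 p.1.1 p.1.2 p.2.

Definition lebesgue3 (R : realType) :
    {measure set (measurableTypeR R * measurableTypeR R * measurableTypeR R)
       -> \bar R} :=
  ((@lebesgue_measure R \x @lebesgue_measure R) \x @lebesgue_measure R)%E.

(* A map on R^3 minus the origin is represented by a total function whose value
   at 0 is never constrained. *)
Definition is_density (R : realType) (G : 'rV[R]_3 -> 'rV[R]_3)
    (rho : 'rV[R]_3 -> R) : Prop :=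
  [/\ C1_field_zero G,
      C1_on [set p | p != 0] rho,
      forall p, p != 0 -> 0 <= rho p,
      exists2 r : R, 0 < r &
        (@lebesgue3 R).-integrable [set p | r <= euclid (of_triple p)]
          (fun p => (rho (of_triple p))%:E)
    & {ae @lebesgue3 R, forall p, 0 < div_density rho G (of_triple p)}].

(* Forward solution on [0, +oo[. For continuous G, the right derivative at 0
   follows from continuity at 0. *)
Definition solution (R : realType) (n : nat) (G : 'rV[R]_n -> 'rV[R]_n)
    (phi : R -> 'rV[R]_n) : Prop :=
  {within `[0, +oo[, continuous phi} /\
  forall t : R, 0 < t -> is_derive t 1 phi (G (phi t)).

(* For locally Lipschitz G, the second clause says that all maximal solutions
   are defined for every t >= 0. *)
Definition globally_asymptotically_stable (R : realType) (n : nat)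
    (G : 'rV[R]_n -> 'rV[R]_n) : Prop :=
  [/\ G 0 = 0,
      forall p, exists2 phi, solution G phi & phi 0 = p,
      forall eps : R, 0 < eps -> exists2 delta : R, 0 < delta &
        forall phi, solution G phi -> euclid (phi 0) < delta ->
          forall t : R, 0 <= t -> euclid (phi t) < eps
    & forall phi, solution G phi -> phi t @[t --> +oo] --> (0 : 'rV[R]_n)].

Definition even_poly_fun (R : realType) (k : nat) (coef : nat -> R)
    (z : R) : R :=
  \sum_(1 <= i < k.+1) coef (2 * i)%N * z ^+ (2 * i).

Definition field_F (R : realType) (a b c : R) (k : nat) (coef : nat -> R)
    (p : 'rV[R]_3) : 'rV[R]_3 :=
  let x := p 0 0 in let y := p 0 1 in let z := p 0 2%:R in
  let Rz := even_poly_fun k coef z in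
  vec3 y (- x) 0 +
  vec3 ((a * x + b * y) * Rz) ((- b * x + c * y) * Rz) (- z * Rz).

Definition field_G (R : realType) (a b c lambda : R) (k : nat)
    (coef : nat -> R) (p : 'rV[R]_3) : 'rV[R]_3 :=
  lambda *: p + field_F a b c k coef p.

Definition density_rho (R : realType) (k : nat) (coef : nat -> R) (alpha : R)
    (p : 'rV[R]_3) : R :=
  (p 0 0 ^+ 2 + p 0 1 ^+ 2 + even_poly_fun k coef (p 0 2%:R)) `^ (- alpha).

(* Main.v *)
From HB Require Import structures.
Require Import Defs.
From mathcomp Require Import all_boot all_order all_algebra.
From mathcomp Require Import complex ring lra.
From mathcomp Require Import all_classical all_reals all_analysis.
From mathcomp Require Import measurable_realfun.
Import Order.TTheory GRing.Theory Num.Theory.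
Import numFieldNormedType.Exports.
Local Open Scope classical_set_scope.
Local Open Scope ring_scope.

(** The linear part of F and its [b]-terms only rotate the (x, y)-coordinates and
contribute nothing to the Euclidean scalar product <p, G p>; since a, c < 0 and
R >= 0, what remains gives
[<p, G p> = lambda |p|^2 + R(z) (a x^2 + c y^2 - z^2) <= lambda |p|^2].
This inequality is the whole of global asymptotic stability: along a solution
|phi(t)|^2 exp(-2 lambda t) is nonincreasing ([energy_decay]), so solutions stay
in the ball in which they start and converge exponentially to 0.
What takes work is that solutions exist on [0, +oo[.  A globally Lipschitz
field has global solutions by Picard iteration ([lipschitz_solution]); a C1
dissipative field is made globally Lipschitz by composing it with the radial
retraction onto a large ball, and the same energy estimate shows that the
solution of the modified field never leaves the ball, hence solves the original
equation ([dissipative_stable]).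

For the Hurwitz property, the Jacobian is block triangular.  The z-block is
lambda - R - z R' < 0; the (x, y)-block is a diagonal matrix with entries
lambda + a R and lambda + c R, both negative, plus a skew-symmetric one, so its
numerical range lies in the open left half plane ([eigenvalue_field_G]).

For the density, put V = x^2 + y^2 + R(z).  Then div (V^(-alpha) G) is
V^(-alpha - 1) (V div G - alpha <grad V, G>), and expanding the second factor
gives a polynomial expression in x^2, y^2, R and z R' ([div_density_rho]).
Because R is an even polynomial with positive coefficients and degree 2k,
Euler's identity yields 2 R <= z R' <= 2k R; under these bounds each group of
terms is nonnegative for the exponents alpha in the hypothesis, and the part
proportional to -lambda is positive away from 0 ([div_density_rho_gt0]).
Finally V >= m |p|^2 with m = min(1, a_2), so off the unit ball V^(-alpha) is at
most a constant times (1 + |p|^2)^(-3), which is dominated by the product of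
the one-variable functions 1 / (1 + x^2); this is where alpha >= 3 enters, and
Tonelli's theorem concludes ([density_rho_integrable]). *)

(** * Continuously differentiable maps *)

Section C1.
Local Set Implicit Arguments.
Local Unset Strict Implicit.
Context {R : realType}.
Implicit Types U V : normedModType R.

(** Continuity of [D_v f] at a point only depends on its values nearby; as the
domain is open, it may be checked on a formula for [D_v f] valid there. *)
Lemma C1_on_derive U V (A : set U) (f : U -> V) (df : U -> U -> V) :
  open A -> (forall x, A x -> differentiable f x) ->
  (forall v x, A x -> 'D_v f x = df v x) ->
  (forall v x, A x -> {for x, continuous (df v)}) -> C1_on A f.
Proof.
move=> oA fd dfE dfc x Ax; split; first exact: fd.
move=> v; rewrite /prop_for /continuous_at dfE//.
apply: cvg_trans (dfc v x Ax); apply: near_eq_cvg.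
have : \forall y \near x, A y by exact: open_nbhs_nbhs.
by apply: filterS => y Ay; rewrite dfE.
Qed.

Lemma C1_on_continuous U V (A : set U) (f : U -> V) x :
  C1_on A f -> A x -> {for x, continuous f}.
Proof. by move=> fA /fA[fd _]; exact: differentiable_continuous. Qed.

Lemma C1_on_cst U V (A : set U) (k : V) : open A -> C1_on A (fun=> k).
Proof.
move=> oA; apply: (@C1_on_derive _ _ _ _ (fun _ _ => 0)) => //.
- by move=> v x _; rewrite derive_cst.
- by move=> v x _; exact: cst_continuous.
Qed.

Lemma is_derive_coord n (p v : 'rV[R]_n) i :
  is_derive p v (fun q : 'rV[R]_n => q 0 i) (v 0 i).
Proof.
have dc : differentiable (fun q : 'rV[R]_n => q 0 i : R) p
  by exact: differentiable_coord.
apply: DeriveDef; first exact: diff_derivable.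
have did : derivable (@id 'rV[R]_n) p v by exact: derivable_id.
have := derive_mx did.
by rewrite derive_id => /rowP/(_ i) ->; rewrite !mxE.
Qed.

Lemma C1_on_coord n (A : set 'rV[R]_n) i :
  open A -> C1_on A (fun q : 'rV[R]_n => q 0 i).
Proof.
move=> oA; apply: (@C1_on_derive _ R A _ (fun v _ => v 0 i : R)) => //.
- by move=> x _; exact: differentiable_coord.
- by move=> v x _; have := is_derive_coord x v i => dx; rewrite derive_val.
- by move=> v x _; exact: cst_continuous.
Qed.

Lemma C1_onD U V (A : set U) (f g : U -> V) :
  open A -> C1_on A f -> C1_on A g -> C1_on A (fun x => f x + g x).
Proof.
move=> oA fA gA.
apply: (@C1_on_derive _ _ _ _ (fun v x => 'D_v f x + 'D_v g x)) => //.
- by move=> x Ax; apply: differentiableD; [apply: (fA _ Ax).1|apply: (gA _ Ax).1].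
- move=> v x Ax; rewrite (@deriveD _ _ _ f g)//; apply: diff_derivable.
  + exact: (fA _ Ax).1.
  + exact: (gA _ Ax).1.
- by move=> v x Ax; apply: continuousD; [apply: (fA _ Ax).2|apply: (gA _ Ax).2].
Qed.

Lemma C1_onM U (A : set U) (f g : U -> R) :
  open A -> C1_on A f -> C1_on A g -> C1_on A (fun x => f x * g x).
Proof.
move=> oA fA gA.
apply: (@C1_on_derive _ _ _ _ (fun v x => f x * 'D_v g x + g x * 'D_v f x)) => //.
- by move=> x Ax; apply: differentiableM; [apply: (fA _ Ax).1|apply: (gA _ Ax).1].
- move=> v x Ax; rewrite (@deriveM _ _ f g)//; apply: diff_derivable.
  + exact: (fA _ Ax).1.
  + exact: (gA _ Ax).1.
- move=> v x Ax; apply: continuousD.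
  + by apply: continuousM; [exact: C1_on_continuous fA _|apply: (gA _ Ax).2].
  + by apply: continuousM; [exact: C1_on_continuous gA _|apply: (fA _ Ax).2].
Qed.

Lemma is_derive_comp1 U (f : U -> R) (g : R -> R) (dg : R) (x v : U) :
  differentiable f x -> is_derive (f x) 1 g dg ->
  is_derive x v (g \o f) (dg * 'D_v f x).
Proof.
move=> fd gd.
have gD : differentiable g (f x) by apply/derivable1_diffP; exact: ex_derive.
have gfD : differentiable (g \o f) x by exact: differentiable_comp.
apply: DeriveDef; first exact: diff_derivable.
rewrite deriveE// diff_comp//= diff1E// derive1E derive_val -deriveE//.
by rewrite -[LHS]/('D_v f x * dg) mulrC.
Qed.

(** The outer function is only differentiated on the range of the inner one, so
that powers with a real exponent may be composed with positive functions. *)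
Lemma C1_on_comp1 U (A : set U) (f : U -> R) (g dg : R -> R) :
  open A -> C1_on A f ->
  (forall x, A x -> is_derive (f x) 1 g (dg (f x))) ->
  (forall x, A x -> {for f x, continuous dg}) -> C1_on A (fun x => g (f x)).
Proof.
move=> oA fA gd dgc.
apply: (@C1_on_derive _ _ _ _ (fun v x => dg (f x) * 'D_v f x)) => //.
- move=> x Ax; have := gd _ Ax => gdx; apply: differentiable_comp.
    exact: (fA _ Ax).1.
  by apply/derivable1_diffP; exact: ex_derive.
- move=> v x Ax; have := is_derive_comp1 v (fA _ Ax).1 (gd _ Ax).
  by move=> d; rewrite -[LHS]/('D_v (g \o f) x) derive_val.
- move=> v x Ax; apply: continuousM; last exact: (fA _ Ax).2.
  by apply: continuous_comp; [exact: C1_on_continuous fA _|exact: dgc].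
Qed.

Lemma differentiable_row U n (f : U -> 'rV[R]_n) x :
  (forall i, differentiable (fun y => f y 0 i) x) -> differentiable f x.
Proof.
move=> fd; rewrite (_ : f = \sum_(i < n) (fun y => f y 0 i *: delta_mx 0 i)).
  by apply: differentiable_sum => i; exact: differentiableZl.
by apply/funext => y; rewrite fct_sumE [LHS]row_sum_delta.
Qed.

Lemma continuous_row (T : topologicalType) n (f : T -> 'rV[R]_n) (x : T) :
  (forall i, {for x, continuous (fun y => f y 0 i)}) -> {for x, continuous f}.
Proof.
move=> fc; apply/cvgrPdist_le => e e0.
have : \forall y \near x, forall i, `|f x 0 i - f y 0 i| <= e.
  by apply: filter_forall => i; move/cvgrPdist_le : (fc i) => /(_ _ e0).
apply: filterS => y xy.
rewrite /Num.Def.normr/= mx_normrE (bigmax_le _ (ltW e0))//= => -[i j] _ /=.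
by rewrite ord1 !mxE.
Qed.

Lemma C1_on_row U n (A : set U) (f : U -> 'rV[R]_n) :
  open A -> (forall i, C1_on A (fun x => f x 0 i)) -> C1_on A f.
Proof.
move=> oA fA.
have fd x : A x -> differentiable f x.
  by move=> Ax; apply: differentiable_row => i; exact: (fA i _ Ax).1.
apply: (@C1_on_derive _ _ _ _ (fun v x => \row_i 'D_v (fun y => f y 0 i) x)) => //.
- move=> v x Ax; rewrite derive_mx; last exact/diff_derivable/fd.
  by apply/rowP => i; rewrite !mxE.
- move=> v x Ax; apply: continuous_row => i.
  rewrite (_ : (fun _ => _) = 'D_v (fun y => f y 0 i)); last first.
    by apply/funext => y; rewrite mxE.
  exact: (fA i _ Ax).2.
Qed.

Lemma C1_on_component U n (A : set U) (f : U -> 'rV[R]_n) i :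
  open A -> C1_on A f -> C1_on A (fun x => f x 0 i).
Proof.
move=> oA fA; have fd x : A x -> differentiable f x by move=> /fA[].
apply: (@C1_on_derive _ R A _ (fun v x => ('D_v f x) 0 i : R)) => //.
- move=> x Ax; apply: (@differentiable_comp _ _ _ _ f (fun M : 'rV[R]_n => M 0 i)).
    exact: fd.
  exact: differentiable_coord.
- move=> v x Ax; rewrite derive_mx; last exact/diff_derivable/fd.
  by rewrite mxE.
- move=> v x Ax.
  apply: (@continuous_comp _ _ _ ('D_v f) (fun M : 'rV[R]_n => M 0 i)).
    exact: (fA _ Ax).2.
  exact: coord_continuous.
Qed.

End C1.

(** * Global solutions of Lipschitz differential equations *)

Section integral_curves.
Local Set Implicit Arguments.
Local Unset Strict Implicit.
Context {R : realType}.

Lemma continuous_max0 : continuous (fun t : R => Num.max 0 t).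
Proof.
by move=> t; apply: (@continuous_max R R^o (fun=> 0) id); [exact: cst_continuous|].
Qed.

(** The integral is taken from -1, so that it is differentiable at 0 from both
sides, and then frozen on the negative half-line: iterates of the integral
operator stay continuous on the whole line, which avoids continuity relative to
a half-line in the fixed point argument. *)
Lemma antiderivative (g : R -> R) : continuous g ->
  exists P : R -> R, [/\ continuous P, forall t : R, t <= 0 -> P t = 0 &
    forall t : R, 0 < t -> is_derive t 1 P (g t)].
Proof.
move=> gc; pose mu := @lebesgue_measure R.
pose I (x : R) : R := (\int[mu]_(t in [set` `[-1, x]]) g t)%R.
have gi (u : R) : mu.-integrable [set` `[-1, u]] (EFin \o g).
  apply: continuous_compact_integrable; first exact: segment_compact.
  exact: continuous_subspaceT.
have Id (x : R) : -1 < x -> is_derive x 1 I (g x).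
  move=> x1; have x2 : x < x + 1 by rewrite ltrDl.
  have [Ix dI] := continuous_FTC1_closed x2 (gi _) x1 (gc x).
  exact: DeriveDef Ix (etrans (esym (derive1E _ _)) dI).
have m0 (t : R) : -1 < Num.max 0 t by rewrite lt_max ltrN10.
exists (fun t => I (Num.max 0 t) - I 0); split.
- move=> t; apply: cvgB; last exact: cvg_cst.
  apply: (cvg_comp _ I (@continuous_max0 t)).
  apply: differentiable_continuous; apply/derivable1_diffP.
  by have := Id _ (m0 t) => ?; exact: ex_derive.
- by move=> t t0; rewrite max_l// subrr.
- move=> t t0; have It := Id t (lt_trans (ltrN10 _) t0).
  apply: (@near_eq_is_derive _ _ _ (fun x => I x - I 0)).
  + apply: filterS (lt_nbhsr t0) => x x0 /=.
    by rewrite max_r// ltW.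
  + by rewrite -[g t]subr0; apply: is_deriveB.
Qed.

Lemma is_derive_row n (u : R -> 'rV[R]_n) (t : R) (w : 'rV[R]_n) :
  is_derive t 1 u w <-> forall i, is_derive t 1 (fun s => u s 0 i) (w 0 i).
Proof.
split=> [du i|du].
- have ut : derivable u t 1 by exact: ex_derive.
  apply: DeriveDef; first by move/derivable_mxP : ut.
  by have := derive_mx ut; rewrite derive_val => /rowP/(_ i); rewrite !mxE.
- have ut : derivable u t 1.
    by apply/derivable_mxP => i j; rewrite ord1; have := du j => ?; exact: ex_derive.
  apply: DeriveDef => //; rewrite derive_mx//; apply/rowP => i; rewrite !mxE.
  by have := du i => ?; rewrite derive_val.
Qed.

Lemma norm_row_le n (x : 'rV[R]_n) (e : R) :
  0 <= e -> (forall i, `|x 0 i| <= e) -> `|x| <= e.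
Proof.
move=> e0 xe; rewrite /Num.Def.normr/= mx_normrE (bigmax_le _ e0)//= => -[i j] _ /=.
by rewrite ord1.
Qed.

Lemma le_norm_row n (x : 'rV[R]_n) i : `|x 0 i| <= `|x|.
Proof.
by rewrite [leRHS]/Num.Def.normr/= mx_normrE (le_bigmax _ _ (0, i)).
Qed.

Lemma le_derive_le (f df : R -> R) :
  {within `[0, +oo[, continuous f} ->
  (forall t : R, 0 < t -> is_derive t 1 f (df t)) ->
  (forall t : R, 0 < t -> df t <= 0) -> forall t : R, 0 <= t -> f t <= f 0.
Proof.
move=> fc fd df0 t t0; apply: (@ler0_derive1_nincry _ f 0) => //.
- by move=> x; rewrite in_itv/= andbT => /fd ?; exact: ex_derive.
- move=> x; rewrite in_itv/= andbT => x0; have := fd _ x0 => ?.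
  by rewrite derive1E derive_val df0.
Qed.

(** Mean value inequality for the sup norm: each coordinate, added to or
subtracted from the majorant, is monotone. *)
Lemma norm_growth_le n (u w : R -> 'rV[R]_n) (h dh : R -> R) :
  continuous u -> continuous h ->
  (forall t : R, 0 < t -> is_derive t 1 u (w t)) ->
  (forall t : R, 0 < t -> is_derive t 1 h (dh t)) ->
  (forall t : R, 0 < t -> `|w t| <= dh t) ->
  forall t : R, 0 <= t -> `|u t - u 0| <= h t - h 0.
Proof.
move=> uc hc ud hd wh t t0.
have uci i : continuous (fun s => u s 0 i).
  by move=> s; apply: (@continuous_comp _ _ _ u (fun x : 'rV[R]_n => x 0 i));
    [exact: uc|exact: coord_continuous].
have wi i s : 0 < s -> `|w s 0 i| <= dh s.
  by move=> s0; apply: le_trans (wh _ s0); exact: le_norm_row.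
have H i : `|u t 0 i - u 0 0 i| <= h t - h 0.
  rewrite ler_norml; apply/andP; split.
    have : (- h t - u t 0 i) <= (- h 0 - u 0 0 i).
      apply: (@le_derive_le (fun s => - h s - u s 0 i)
                            (fun s => - dh s - w s 0 i)) => //.
      + apply: continuous_subspaceT => s; apply: cvgB; last exact: uci.
        apply: cvgN; exact: hc.
      + move=> s s0; apply: is_deriveB; first by have := hd _ s0 => ?; exact: is_deriveN.
        by have /is_derive_row := ud _ s0; exact.
      + by move=> s s0; have := wi i _ s0; rewrite ler_norml => /andP[]; lra.
    lra.
  have : (u t 0 i - h t) <= (u 0 0 i - h 0).
    apply: (@le_derive_le (fun s => u s 0 i - h s)
                          (fun s => w s 0 i - dh s)) => //.
    + apply: continuous_subspaceT => s; apply: cvgB; first exact: uci.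
      exact: hc.
    + move=> s s0; apply: is_deriveB; last by have := hd _ s0 => ?; exact: hd.
      by have /is_derive_row := ud _ s0; exact.
    + by move=> s s0; have := wi i _ s0; rewrite ler_norml => /andP[]; lra.
  lra.
apply: norm_row_le; last by move=> i; rewrite !mxE.
(* in dimension 0 no coordinate tells that [h] is nondecreasing; the bound
   [0 <= |w| <= dh] does *)
case: n u w uc ud wh uci wi H => [|n] u w uc ud wh uci wi H; last first.
  exact: le_trans (normr_ge0 _) (H ord0).
rewrite subr_ge0 -lerN2.
apply: (@le_derive_le (fun s => - h s) (fun s => - dh s)) => //.
- by apply: continuous_subspaceT => s; apply: cvgN; exact: hc.
- by move=> s s0; have := hd _ s0 => ?; exact: is_deriveN.
- by move=> s s0; rewrite oppr_le0; apply: le_trans (wh _ s0).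
Qed.

Lemma small_half_exp (c e : R) : 0 <= c -> 0 < e -> exists k, c / 2 ^+ k < e.
Proof.
move=> c0 e0; have ce : 0 <= c / e by rewrite divr_ge0// ltW.
exists (Num.bound (c / e)); rewrite ltr_pdivrMr ?exprn_gt0// mulrC -ltr_pdivrMr//.
apply: lt_le_trans (archi_boundP ce) _.
by rewrite -natrX ler_nat ltnW// ltn_expl.
Qed.

(** The error bound [2 C / 2^k] is part of the conclusion; on each coordinate
[a_k - 2 C / 2^k] increases, [a_k + 2 C / 2^k] decreases, and the supremum of
the former is the limit. *)
Lemma geometric_limit n (v : nat -> 'rV[R]_n) (C : R) :
  (forall k, `|v k.+1 - v k| <= C / 2 ^+ k) ->
  exists l, forall k, `|l - v k| <= 2 * C / 2 ^+ k.
Proof.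
move=> vC.
have C0 k : 0 <= C / 2 ^+ k by apply: le_trans (vC k).
have H i : exists l : R, forall k, `|l - v k 0 i| <= 2 * C / 2 ^+ k.
  pose a k := v k 0 i; pose d k := 2 * C / 2 ^+ k.
  have dS k : d k.+1 = C / 2 ^+ k by rewrite /d exprS invfM mulrACA divff// mul1r.
  have dE k : d k = 2 * (C / 2 ^+ k) by rewrite /d mulrA.
  have aS k : `|a k.+1 - a k| <= C / 2 ^+ k.
    by apply: le_trans (vC k); have := le_norm_row (v k.+1 - v k) i; rewrite !mxE.
  have lo : nondecreasing_seq (fun k => a k - d k).
    apply/nondecreasing_seqP => k; have := aS k.
    by rewrite ler_norml dS dE => /andP[]; lra.
  have hi : nonincreasing_seq (fun k => a k + d k).
    apply/nonincreasing_seqP => k; have := aS k.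
    by rewrite ler_norml dS dE => /andP[]; lra.
  have lohi j k : a j - d j <= a k + d k.
    have := lo _ _ (leq_maxl j k); have := hi _ _ (leq_maxr j k).
    have : 0 <= d (maxn j k) by rewrite dE mulr_ge0.
    lra.
  pose S := range (fun k => a k - d k).
  have Sne : S !=set0 by exists (a 0 - d 0), 0.
  have Sub k : ubound S (a k + d k) by move=> _ [j _ <-]; exact: lohi.
  exists (sup S) => k; rewrite -/(a k) -/(d k) ler_norml.
  have : sup S <= a k + d k by apply: ge_sup.
  have : a k - d k <= sup S.
    by apply: ub_le_sup; [exists (a 0 + d 0); exact: Sub|exists k].
  lra.
have [l Hl] := choice H.
exists (\row_i l i) => k; apply: norm_row_le; last by move=> i; rewrite !mxE.
by have := C0 k; rewrite -mulrA; lra.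
Qed.

Lemma is_derive_expM (c m t : R) :
  is_derive t 1 (fun s => c * expR (m * s)) (c * (m * expR (m * t))).
Proof.
have dm : is_derive t 1 ( *%R m) (m * 1) by exact: is_deriveZ.
have := @is_derive1_comp R expR ( *%R m) t _ _ (is_derive_expR _) dm.
rewrite mulr1 => de.
rewrite [m * _]mulrC.
exact: (@is_deriveZ R R R (fun s => expR (m * s)) c t 1 _ de).
Qed.

Lemma continuous_expM (c m : R) : continuous (fun s => c * expR (m * s)).
Proof.
move=> t; apply: differentiable_continuous; apply/derivable1_diffP.
by have := is_derive_expM c m t => ?; exact: ex_derive.
Qed.

Lemma antiderivative_row n (g : R -> 'rV[R]_n) : continuous g ->
  exists P : R -> 'rV[R]_n, [/\ continuous P, forall t : R, t <= 0 -> P t = 0 &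
    forall t : R, 0 < t -> is_derive t 1 P (g t)].
Proof.
move=> gc.
have gic i : continuous (fun s => g s 0 i).
  by move=> s; apply: (@continuous_comp _ _ _ g (fun x : 'rV[R]_n => x 0 i));
    [exact: gc|exact: coord_continuous].
have [P HP] := choice (fun i => antiderivative (gic i)).
exists (fun t => \row_i P i t); split.
- move=> t; apply: continuous_row => i.
  rewrite (_ : (fun _ => _) = P i); last by apply/funext => y; rewrite mxE.
  by have [Pc _ _] := HP i; exact: Pc.
- by move=> t t0; apply/rowP => i; rewrite !mxE; have [_ ->] := HP i.
- move=> t t0; apply/is_derive_row => i.
  rewrite (_ : (fun _ => _) = P i); last by apply/funext => y; rewrite mxE.
  by have [_ _] := HP i; exact.
Qed.

Lemma lipschitz_continuous (V W : normedModType R) (f : V -> W) (L : R) :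
  0 < L -> (forall x y, `|f x - f y| <= L * `|x - y|) -> continuous f.
Proof.
move=> L0 fL x; apply/cvgrPdist_le => e e0.
have e1 : 0 < L^-1 * e by rewrite mulr_gt0// invr_gt0.
have := nbhsx_ballx x _ e1; apply: filterS => y; rewrite -ball_normE/= => xy.
by apply: le_trans (fL _ _) _; rewrite -ler_pdivlMl// ltW.
Qed.

(** Picard iteration.  Distances are weighted by [exp (2 L t)]: for this weight
the integral operator is a contraction with ratio 1/2 on the whole half-line, so
no restriction to short times and no gluing is needed. *)
Lemma lipschitz_solution n (f : 'rV[R]_n -> 'rV[R]_n) (L : R) (p : 'rV[R]_n) :
  0 < L -> (forall x y, `|f x - f y| <= L * `|x - y|) ->
  exists2 phi, solution f phi & phi 0 = p.
Proof.
move=> L0 fL.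
have fc : continuous f by exact: lipschitz_continuous L0 fL.
have /choice[J HJ] : forall g : R -> 'rV[R]_n, exists P : R -> 'rV[R]_n,
    continuous g -> [/\ continuous P, forall t : R, t <= 0 -> P t = 0 &
    forall t : R, 0 < t -> is_derive t 1 P (g t)].
  move=> g; have [gc|ngc] := pselect (continuous g); last by exists g.
  by have [P HP] := antiderivative_row gc; exists P.
pose T (v : R -> 'rV[R]_n) (t : R) := p + J (f \o v) t.
have fuc (v : R -> 'rV[R]_n) : continuous v -> continuous (f \o v).
  by move=> vc t; exact: (cvg_comp _ f (vc t) (fc _)).
have Tc (v : R -> 'rV[R]_n) : continuous v -> continuous (T v).
  move=> vc t; apply: cvgD; first exact: cvg_cst.
  by have [Jc _ _] := HJ _ (fuc _ vc); exact: Jc.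
have T0 (v : R -> 'rV[R]_n) : continuous v -> forall t : R, t <= 0 -> T v t = p.
  by move=> vc t t0; have [_ J0 _] := HJ _ (fuc _ vc); rewrite /T J0// addr0.
have Td (v : R -> 'rV[R]_n) : continuous v -> forall t : R, 0 < t -> is_derive t 1 (T v) (f (v t)).
  move=> vc t t0; have [_ _ Jd] := HJ _ (fuc _ vc); rewrite -[f _]add0r.
  by have := Jd _ t0 => ?; exact: is_deriveD.
pose E (t : R) := expR (2 * L * t).
have E0 t : 0 < E t by exact: expR_gt0.
(* the contraction estimate: [f] multiplies the distance by at most [L], and
   integrating [exp (2 L t)] divides it by [2 L] *)
have contr (v w : R -> 'rV[R]_n) (c : R) : continuous v -> continuous w ->
    (forall t : R, 0 < t -> `|v t - w t| <= c * E t) ->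
    forall t : R, 0 <= t -> `|T v t - T w t| <= c / 2 * E t.
  move=> vc wc vw t t0.
  have c0 : 0 <= c.
    have := le_trans (normr_ge0 _) (vw 1 ltr01).
    by rewrite pmulr_lge0.
  have := @norm_growth_le n (fun s => T v s - T w s)
    (fun s => f (v s) - f (w s)) (fun s => c / 2 * E s)
    (fun s => c / 2 * (2 * L * E s)) _ _ _ _ _ t t0.
  rewrite /= (T0 v vc 0)// (T0 w wc 0)// subrr subr0 => H; apply: le_trans (H _ _ _ _ _) _.
  - by move=> s; apply: cvgB; exact: Tc.
  - exact: continuous_expM.
  - by move=> s s0; have := Td _ vc _ s0 => ?; have := Td _ wc _ s0 => ?; exact: is_deriveB.
  - by move=> s s0; exact: is_derive_expM.
  - move=> s s0; apply: le_trans (fL _ _) _.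
    have -> : c / 2 * (2 * L * E s) = L * (c * E s) by field.
    by rewrite ler_pM2l// vw.
  - by rewrite gerBl mulr_ge0// ?divr_ge0// ltW.
pose u k := iter k T (fun=> p).
have uc k : continuous (u k).
  by elim: k => [|k IH]; [move=> t; exact: cvg_cst|exact: Tc].
have u0 k (t : R) : t <= 0 -> u k t = p by case: k => [//|k] t0; exact: T0.
pose K := `|f p| / L.
have K0 : 0 <= K by rewrite divr_ge0// ltW.
have du k (t : R) : 0 <= t -> `|u k.+1 t - u k t| <= K / 2 ^+ k * E t.
  elim: k t => [|k IH] t t0; last first.
    rewrite -[leLHS]/(`|T (u k.+1) t - T (u k) t|).
    rewrite exprSr invfM mulrA; apply: contr => //.
    by move=> s s0; exact/IH/ltW.
  rewrite expr0 divr1.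
  have := @norm_growth_le n (u 1)
    (fun s => f p) (fun s => K / 2 * E s)
    (fun s => K / 2 * (2 * L * E s)) _ _ _ _ _ t t0.
  rewrite /= (T0 (u 0%N) (uc 0%N) 0)// => H; apply: le_trans (H _ _ _ _ _) _.
  - exact: (uc 1%N).
  - exact: continuous_expM.
  - by move=> s s0; exact: (Td (u 0%N) (uc 0%N)).
  - by move=> s s0; exact: is_derive_expM.
  - move=> s s0; have -> : K / 2 * (2 * L * E s) = `|f p| * E s.
      by rewrite /K; field; rewrite gt_eqF.
    by rewrite ler_peMr// -expR0 ler_expR mulr_ge0 ?ltW// mulr_gt0.
  - have := E0 0; have : 0 <= K * E t by rewrite mulr_ge0// ltW.
    have : 0 <= K * E 0 by rewrite mulr_ge0// ltW.
    lra.
(* for negative times all iterates are equal to [p] *)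
pose E' (t : R) := E (Num.max 0 t).
have /choice[U HU] : forall t, exists l, forall k,
    `|l - u k t| <= 2 * (K * E' t) / 2 ^+ k.
  move=> t; apply: geometric_limit => k.
  rewrite mulrAC /E'; have [t0|t0] := leP 0 t; first by rewrite du.
  rewrite (u0 _ _ (ltW t0)) (u0 _ _ (ltW t0)) subrr normr0.
  by apply: mulr_ge0; [apply: divr_ge0; rewrite ?exprn_ge0|exact: ltW].
(* the convergence is uniform on bounded sets of times *)
have Uc : continuous U.
  move=> s; apply/cvgrPdist_le => e e0.
  pose B := 2 * (K * E (Num.max 0 s + 1)).
  have B0 : 0 <= B by rewrite /B -/E; do 2!apply: mulr_ge0 => //; exact: expR_ge0.
  have [k kB] := small_half_exp B0 (divr_gt0 e0 (ltr0n R 3)).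
  have UB (t : R) : t < s + 1 -> `|U t - u k t| <= e / 3.
    move=> ts; apply: le_trans (HU t k) _; apply: le_trans (ltW kB).
    rewrite ler_pM2r ?invr_gt0 ?exprn_gt0// /B !ler_wpM2l//.
    rewrite /E' /E ler_expR ler_wpM2l ?mulr_ge0 ?ltW// gt_max.
    rewrite ltr_wpDl// ?le_max ?lexx//=.
    by apply: lt_le_trans ts _; rewrite lerD2r le_max lexx orbT.
  near=> t.
  have ts : t < s + 1 by near: t; apply: lt_nbhsl; rewrite ltrDl.
  have us : `|u k s - u k t| <= e / 3.
    near: t; have e3 : 0 < e / 3 by rewrite divr_gt0.
    by have := uc k s => /cvgrPdist_le/(_ _ e3).
  have ss : s < s + 1 by rewrite ltrDl.
  have -> : U s - U t = (U s - u k s) + (u k s - u k t) - (U t - u k t).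
    by rewrite opprB !addrA !subrK.
  apply: le_trans (ler_normB _ _) _; apply: le_trans (lerD (ler_normD _ _) (lexx _)) _.
  have := UB _ ts; have := UB _ ss; lra.
have UT (t : R) : 0 <= t -> U t = T U t.
  move=> t0; apply/eqP; rewrite -subr_eq0 -normr_le0.
  apply/ler_addgt0Pr => e e0; rewrite add0r.
  have B0 : 0 <= 2 * K * E t by do 2?apply: mulr_ge0 => //; exact: expR_ge0.
  have [k kB] := small_half_exp B0 e0.
  apply: le_trans (ltW kB).
  have UE (s : R) j : 0 <= s -> `|U s - u j s| <= 2 * K / 2 ^+ j * E s.
    move=> s0; apply: le_trans (HU s j) _; rewrite /E' max_r//.
    by rewrite le_eqVlt; apply/orP; left; apply/eqP; ring.
  have H1 := UE t k.+1 t0.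
  have H2 : `|T U t - u k.+1 t| <= 2 * K / 2 ^+ k / 2 * E t.
    by apply: contr => // s s0; exact/UE/ltW.
  have -> : U t - T U t = (U t - u k.+1 t) - (T U t - u k.+1 t).
    by rewrite opprB addrA subrK.
  apply: le_trans (ler_normB _ _) _; apply: le_trans (lerD H1 H2) _.
  rewrite exprSr invfM le_eqVlt; apply/orP; left; apply/eqP.
  by field; rewrite expf_neq0.
(* [T U] is differentiable by construction, and it agrees with [U] where it
   matters *)
exists (T U); last exact: T0.
split; first by apply: continuous_subspaceT; exact: Tc.
by move=> t t0; rewrite -UT ?ltW//; exact: Td.
Unshelve. all: by end_near. Qed.

End integral_curves.

(** * Energy estimate *)

Section energy.
Local Set Implicit Arguments.
Local Unset Strict Implicit.
Context {R : realType}.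

Definition dotr n (p q : 'rV[R]_n) : R := \sum_(i < n) p 0 i * q 0 i.

Lemma dotr_ge0 n (p : 'rV[R]_n) : 0 <= dotr p p.
Proof. by apply: sumr_ge0 => i _; rewrite -expr2 sqr_ge0. Qed.

Lemma euclidE n (p : 'rV[R]_n) : euclid p = Num.sqrt (dotr p p).
Proof. by congr Num.sqrt; apply: eq_bigr => i _; rewrite expr2. Qed.

Lemma norm_le_euclid n (p : 'rV[R]_n) : `|p| <= euclid p.
Proof.
apply: norm_row_le => [|i]; first exact: sqrtr_ge0.
rewrite -sqrtr_sqr; apply: ler_wsqrtr.
by rewrite (bigD1 i)//= lerDl sumr_ge0// => j _; rewrite sqr_ge0.
Qed.

(** The derivative of [|phi|^2 exp (- 2 m t)] is
[2 (<phi, H phi> - m |phi|^2) exp (- 2 m t)], which the hypothesis makes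
nonpositive. *)
Lemma energy_decay n (H : 'rV[R]_n -> 'rV[R]_n) (m : R) (phi : R -> 'rV[R]_n) :
  (forall p, dotr p (H p) <= m * dotr p p) -> solution H phi ->
  forall t : R, 0 <= t ->
    dotr (phi t) (phi t) <= expR (2 * m * t) * dotr (phi 0) (phi 0).
Proof.
move=> Hm [phic phid] t t0.
pose g (s : R) := dotr (phi s) (phi s) * (1 * expR (- (2 * m) * s)).
suff : g t <= g 0.
  rewrite /g !mul1r mulr0 expR0 mulr1 mulNr expRN.
  by rewrite ler_pdivrMr ?expR_gt0// mulrC.
apply: (@le_derive_le _ g (fun s => dotr (phi s) (phi s) *
    (1 * (- (2 * m) * expR (- (2 * m) * s))) +
    (1 * expR (- (2 * m) * s)) * (2 * dotr (phi s) (H (phi s))))) => //.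
- have ec : {within `[0, +oo[, continuous (fun s => 1 * expR (- (2 * m) * s))}.
    by apply: continuous_subspaceT; exact: continuous_expM.
  have dc : {within `[0, +oo[, continuous (fun s => dotr (phi s) (phi s))}.
    have -> : (fun s => dotr (phi s) (phi s)) =
        \sum_(i < n) (fun s => phi s 0 i * phi s 0 i).
      by apply/funext => u; rewrite fct_sumE.
    have c i : {within `[0, +oo[, continuous (fun s => phi s 0 i)}.
      move=> u; apply: (@continuous_comp _ _ _ (phi : subspace `[0, +oo[ -> 'rV[R]_n)
        (fun x : 'rV[R]_n => x 0 i)); [exact: phic|exact: coord_continuous].
    elim/big_ind : _ => [|a b ac bc|i _] u; first exact: cvg_cst.
      by apply: cvgD; [exact: ac|exact: bc].
    by apply: cvgM; exact: c.
  by move=> s; rewrite /g; apply: cvgM; [exact: dc|exact: ec].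
- move=> s s0; apply: is_deriveM; last exact: is_derive_expM.
  have -> : (fun s => dotr (phi s) (phi s)) =
      \sum_(i < n) (fun s => phi s 0 i * phi s 0 i).
    by apply/funext => u; rewrite fct_sumE.
  rewrite /dotr mulr_sumr; apply: is_derive_sum => i.
  have /is_derive_row/(_ i) d := phid _ s0.
  have := is_deriveM d d; rewrite -[_ *: _ + _]/(_ * _ + _ * _).
  by rewrite -mulr2n mulr_natl.
- move=> s s0; have e0 : 0 < expR (- (2 * m) * s) by exact: expR_gt0.
  have := Hm (phi s); rewrite -(ler_pM2l e0) -subr_le0; lra.
Qed.

End energy.

(** * Dissipative fields are globally asymptotically stable *)

Section dissipative.
Local Set Implicit Arguments.
Local Unset Strict Implicit.
Context {R : realType}.

Lemma compact_box n (M : R) : compact [set p : 'rV[R]_n | `|p| <= M].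
Proof.
have -> : [set p : 'rV[R]_n | `|p| <= M] =
    closed_ball_ Num.norm (0 : 'rV[R]_n) M.
  by apply/seteqP; split => p /=; rewrite /closed_ball_/= sub0r normrN.
apply: bounded_closed_compact; last exact: closed_closed_ball_.
exists M; split; first exact: num_real.
by move=> N MN p; rewrite /closed_ball_/= sub0r normrN => /le_trans; apply; exact: ltW.
Qed.

(** Differentiability makes [D_v g] linear in [v]. *)
Lemma derive_row_sum n (g : 'rV[R]_n -> R) (p v : 'rV[R]_n) :
  differentiable g p -> 'D_v g p = \sum_(j < n) v 0 j * 'D_(delta_mx 0 j) g p.
Proof.
move=> gp; rewrite deriveE// {1}[v]row_sum_delta linear_sum/=.
by apply: eq_bigr => j _; rewrite linearZ/= deriveE.
Qed.

Lemma is_derive_line n (g : 'rV[R]_n -> R) (y v : 'rV[R]_n) (s : R) :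
  differentiable g (s *: v + y) ->
  is_derive s 1 (fun r => g (r *: v + y)) ('D_v g (s *: v + y)).
Proof.
move=> gd; have := diff_derivable (v := v) gd.
rewrite /derivable /derive => gv.
suff E : (fun h : R => h^-1 *: (((fun r => g (r *: v + y)) \o shift s) (h *: 1) -
      g (s *: v + y))) =
    (fun h => h^-1 *: ((g \o shift (s *: v + y)) (h *: v) - g (s *: v + y))).
  by apply: DeriveDef; rewrite /derivable /derive E.
by apply/funext => h; rewrite /= /shift/= [h *: 1]mulr1 scalerDl addrA.
Qed.

(** The partial derivatives are bounded on the closed ball, which is compact, and
the ball contains the segment from [x] to [y] on which the mean value theorem is
applied. *)
Lemma C1_lipschitz n (g : 'rV[R]_n -> R) (M : R) : 0 <= M -> C1_on setT g ->
  exists2 L, 0 <= L & forall x y, `|x| <= M -> `|y| <= M ->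
    `|g x - g y| <= L * `|x - y|.
Proof.
move=> M0 gC1.
have gd p : differentiable g p by have [] := gC1 p I.
have /choice[B HB] : forall j, exists B : R, forall p : 'rV[R]_n, `|p| <= M ->
    `|'D_(delta_mx 0 j) g p| <= B.
  move=> j; have [||c _ cmax] := @EVT_max_rV R n
      (fun p => `|'D_(delta_mx 0 j) g p|) [set p | `|p| <= M] _ (@compact_box n M).
  - by exists 0; rewrite /= normr0.
  - apply: continuous_subspaceT => p; have [_ gc] := gC1 p I.
    by apply: (@continuous_comp _ _ _ ('D_(delta_mx 0 j) g) Num.norm);
      [exact: gc|exact: norm_continuous].
  - by exists `|'D_(delta_mx 0 j) g c| => p pM; apply: cmax; rewrite inE.
have B0 j : 0 <= B j by apply: le_trans (HB j 0 _); rewrite ?normr0.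
exists (\sum_j B j); first exact: sumr_ge0.
move=> x y xM yM; pose v := x - y.
have [||s s01] := @MVT_segment R (fun r => g (r *: v + y))
    (fun r => 'D_v g (r *: v + y)) 0 1 ler01.
- by move=> r _; exact: is_derive_line.
- apply: derivable_within_continuous => r _.
  by have := is_derive_line (s := r) (gd (r *: v + y)) => ?; exact: ex_derive.
rewrite scale1r scale0r add0r subrK subr0 mulr1 => ->.
have sM : `|s *: v + y| <= M.
  move: s01; rewrite in_itv/= => /andP[s0 s1].
  have -> : s *: v + y = s *: x + (1 - s) *: y.
    by rewrite /v scalerBr scalerBl scale1r -addrA [- _ + _]addrC.
  apply: le_trans (ler_normD _ _) _; rewrite !normrZ ger0_norm// ger0_norm ?subr_ge0//.
  have := ler_wpM2l s0 xM; have s1' : 0 <= 1 - s by rewrite subr_ge0.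
  have := ler_wpM2l s1' yM; lra.
rewrite derive_row_sum// mulr_suml; apply: le_trans (ler_norm_sum _ _ _) _.
apply: ler_sum => j _; rewrite normrM mulrC ler_pM//; first exact: HB.
exact: le_norm_row.
Qed.

(** Radial retraction onto the closed ball of radius [M] for the sup norm.  At
every point it is a positive multiple of the identity, so composing with it
preserves the sign of [<p, G p>]; truncating each coordinate would not. *)
Definition retract n (M : R) (p : 'rV[R]_n) : 'rV[R]_n := (M / Num.max M `|p|) *: p.

Lemma retract_id n (M : R) (p : 'rV[R]_n) : 0 < M -> `|p| <= M -> retract M p = p.
Proof. by move=> M0 pM; rewrite /retract max_l// divff ?gt_eqF// scale1r. Qed.

Lemma retract_norm n (M : R) (p : 'rV[R]_n) : 0 < M -> `|retract M p| <= M.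
Proof.
move=> M0; have m0 : 0 < Num.max M `|p| by rewrite lt_max M0.
rewrite normrZ (gtr0_norm (divr_gt0 M0 m0)) mulrAC ler_pdivrMr// ler_pM2l//.
by rewrite le_max lexx orbT.
Qed.

Lemma retract_lipschitz n (M : R) (p q : 'rV[R]_n) : 0 < M ->
  `|retract M p - retract M q| <= 2 * `|p - q|.
Proof.
move=> M0; rewrite /retract.
set a := Num.max M `|p|; set b := Num.max M `|q|.
have a0 : 0 < a by rewrite lt_max M0.
have b0 : 0 < b by rewrite lt_max M0.
have Ma : M <= a by rewrite le_max lexx.
have qb : `|q| <= b by rewrite le_max lexx orbT.
have pq : `| `|p| - `|q| | <= `|p - q| by exact: ler_dist_dist.
have ab : `|b - a| <= `|p - q|.
  apply: le_trans pq; rewrite /a /b /Num.max.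
  by case: ifP; case: ifP; rewrite !ler_norml; do 2?[case: ler0P]; lra.
(* the two terms account for moving the point and for changing the factor; each
   contributes at most [|p - q|], whence the constant 2 *)
have -> : (M / a) *: p - (M / b) *: q =
    (M / a) *: ((p - q) + ((b - a) / b) *: q).
  rewrite scalerDr scalerBr scalerA -addrA; congr (_ + _).
  rewrite -!(scaleNr _ q) -scalerDl; congr (_ *: q).
  by field; rewrite !gt_eqF.
have Ma1 : M / a <= 1 by rewrite ler_pdivrMr// mul1r.
rewrite normrZ (gtr0_norm (divr_gt0 M0 a0)).
apply: le_trans (ler_wpM2r (normr_ge0 _) Ma1) _.
rewrite mul1r; apply: le_trans (ler_normD _ _) _.
rewrite mulr_natl mulr2n lerD2l normrZ normrM normfV (gtr0_norm b0).
by rewrite mulrAC ler_pdivrMr// ler_pM.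
Qed.

(** The field [G \o retract M] is globally Lipschitz and agrees with [G] on the
ball of radius [M].  Its energy does not increase, so its solution from [p]
remains in the Euclidean ball of radius [|p|], which lies in the sup-norm ball of
radius [M], and is therefore a solution of [G]. *)
Lemma dissipative_solution n (G : 'rV[R]_n -> 'rV[R]_n) (m : R) (p : 'rV[R]_n) :
  C1_on setT G -> m <= 0 -> (forall q, dotr q (G q) <= m * dotr q q) ->
  exists2 phi, solution G phi & phi 0 = p.
Proof.
move=> GC1 m0 Gm.
(* adding 1 makes the radius positive when [p = 0] *)
pose M := euclid p + 1.
have M0 : 0 < M by rewrite ltr_wpDl// sqrtr_ge0.
have GiC1 i : C1_on setT (fun x => G x 0 i).
  exact: C1_on_component openT GC1.
have /choice[L HL] : forall i, exists L, 0 <= L /\ forall x y : 'rV[R]_n,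
    `|x| <= M -> `|y| <= M -> `|G x 0 i - G y 0 i| <= L * `|x - y|.
  by move=> i; have [L] := C1_lipschitz (ltW M0) (GiC1 i); exists L.
pose K := 2 * \sum_i L i + 1.
have L0 : 0 <= \sum_i L i by apply: sumr_ge0 => i _; have [] := HL i.
have K0 : 0 < K by rewrite /K; lra.
have [|phi solphi phi0] := @lipschitz_solution R n (G \o retract M) K p K0.
  move=> x y; apply: norm_row_le => [|i]; first by rewrite mulr_ge0// ltW.
  have [Li0 /(_ _ _ (retract_norm x M0) (retract_norm y M0)) H] := HL i.
  rewrite !mxE; apply: le_trans H _.
  apply: le_trans (ler_wpM2l Li0 (retract_lipschitz x y M0)) _.
  rewrite mulrA ler_wpM2r// /K mulrC.
  have : L i <= \sum_i L i.
    by rewrite (bigD1 i)//= lerDl sumr_ge0// => j _; have [] := HL j.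
  lra.
have ret q : dotr q ((G \o retract M) q) <= 0 * dotr q q.
  rewrite mul0r /=; have m1 : 0 < Num.max M `|q| by rewrite lt_max M0.
  have c0 : 0 < M / Num.max M `|q| by rewrite divr_gt0.
  have := Gm (retract M q); rewrite -(pmulr_rle0 _ c0).
  have -> : M / Num.max M `|q| * dotr q (G (retract M q)) =
      dotr (retract M q) (G (retract M q)).
    by rewrite /dotr mulr_sumr; apply: eq_bigr => i _; rewrite mxE mulrA.
  by move=> /le_trans; apply; rewrite mulr_le0_ge0// dotr_ge0.
have bound (t : R) : 0 <= t -> `|phi t| <= M.
  move=> t0; apply: le_trans (norm_le_euclid _) _.
  have := energy_decay ret solphi t0.
  rewrite mulr0 mul0r expR0 mul1r phi0 => H.
  by rewrite euclidE (le_trans (ler_wsqrtr H))// -euclidE lerDl.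
exists phi => //; have [phic phid] := solphi; split => // t t0.
by have := phid t t0; rewrite /= retract_id// bound// ltW.
Qed.

Theorem dissipative_stable n (G : 'rV[R]_n -> 'rV[R]_n) (m : R) :
  C1_on setT G -> G 0 = 0 -> m < 0 ->
  (forall q, dotr q (G q) <= m * dotr q q) ->
  globally_asymptotically_stable G.
Proof.
move=> GC1 G0 m0 Gm; split => //.
- by move=> p; exact: dissipative_solution GC1 (ltW m0) Gm.
- move=> eps eps0; exists eps => // phi solphi phi0 t t0.
  apply: le_lt_trans phi0; rewrite !euclidE; apply: ler_wsqrtr.
  apply: le_trans (energy_decay Gm solphi t0) _.
  rewrite ler_piMl ?dotr_ge0// -expR0 ler_expR.
  by rewrite mulr_le0_ge0// mulr_ge0_le0// ltW.
- move=> phi solphi; apply/cvgrPdist_le => e e0.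
  have e20 : 0 < e ^+ 2 by rewrite exprn_gt0.
  pose C := dotr (phi 0) (phi 0) + 1.
  have C0 : 0 < C by rewrite ltr_wpDl// dotr_ge0.
  have m20 : 2 * m < 0 by rewrite pmulr_rlt0.
  near=> t.
  have t0 : 0 <= t by near: t; apply: nbhs_pinfty_ge; exact: num_real.
  have t1 : ln (e ^+ 2 / C) / (2 * m) <= t.
    by near: t; apply: nbhs_pinfty_ge; exact: num_real.
  rewrite sub0r normrN; apply: le_trans (norm_le_euclid _) _.
  rewrite euclidE -(ger0_norm (ltW e0)) -sqrtr_sqr; apply: ler_wsqrtr.
  apply: le_trans (energy_decay Gm solphi t0) _.
  apply: (@le_trans _ _ (expR (2 * m * t) * C)).
    by rewrite ler_wpM2l ?expR_ge0// lerDl.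
  rewrite -ler_pdivlMr// -[leRHS]lnK ?posrE ?divr_gt0// ler_expR.
  by rewrite mulrC -ler_ndivrMr.
Unshelve. all: by end_near. Qed.

End dissipative.

(** * The even polynomial and the components of the field *)

Section even_polynomial.
Local Set Implicit Arguments.
Local Unset Strict Implicit.
Context {R : realType} (k : nat) (coef : nat -> R).

Definition even_poly : {poly R} :=
  \sum_(1 <= i < k.+1) coef (2 * i)%N *: 'X^(2 * i).

Lemma even_polyE z : even_poly_fun k coef z = even_poly.[z].
Proof.
rewrite horner_sum; apply: eq_bigr => i _.
by rewrite hornerZ hornerXn.
Qed.

Definition even_poly_deriv z := even_poly^`().[z].

Lemma is_derive_even_poly (z : R) :
  is_derive z 1 (even_poly_fun k coef) (even_poly_deriv z).
Proof.
have -> : even_poly_fun k coef = horner even_poly.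
  by apply/funext => x; rewrite even_polyE.
exact: is_derive_poly.
Qed.

Lemma even_poly_deriv_continuous : continuous even_poly_deriv.
Proof. exact: continuous_horner. Qed.

(** Euler's identity, monomial by monomial; the two bounds below follow because
the exponents [2 i] range between [2] and [2 k] and all terms are
nonnegative. *)
Lemma mul_even_poly_deriv z : z * even_poly_deriv z =
  \sum_(1 <= i < k.+1) (2 * i)%:R * (coef (2 * i)%N * z ^+ (2 * i)).
Proof.
rewrite /even_poly_deriv /even_poly raddf_sum/= horner_sum mulr_sumr.
apply: eq_big_nat => i /andP[i1 _].
rewrite derivZ derivXn hornerZ hornerMn hornerXn -mulr_natl.
have /prednK <- : (0 < 2 * i)%N by rewrite muln_gt0.
rewrite exprS; ring.
Qed.

Hypothesis hcoef : forall i : nat, (1 <= i <= k)%N -> 0 < coef (2 * i)%N.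

Let term_ge0 i z : (1 <= i < k.+1)%N -> 0 <= coef (2 * i)%N * z ^+ (2 * i).
Proof.
move=> ik; apply: mulr_ge0; first exact/ltW/hcoef.
by rewrite exprM exprn_ge0// sqr_ge0.
Qed.

Lemma even_poly_ge0 z : 0 <= even_poly_fun k coef z.
Proof.
by rewrite /even_poly_fun big_nat; apply: sumr_ge0 => i; exact: term_ge0.
Qed.

Lemma even_poly_euler_ge z : 2 * even_poly_fun k coef z <= z * even_poly_deriv z.
Proof.
rewrite mul_even_poly_deriv mulr_sumr big_nat [leRHS]big_nat.
apply: ler_sum => i ik; rewrite ler_wpM2r ?term_ge0//.
by rewrite ler_nat leq_pmulr//; case/andP: ik.
Qed.

Lemma even_poly_euler_le z :
  z * even_poly_deriv z <= 2 * k%:R * even_poly_fun k coef z.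
Proof.
rewrite mul_even_poly_deriv mulr_sumr big_nat [leRHS]big_nat.
apply: ler_sum => i ik; rewrite ler_wpM2r ?term_ge0//.
by rewrite -natrM ler_nat leq_mul2l/=; case/andP: ik.
Qed.

Lemma even_poly_ge_quadratic z : (1 <= k)%N ->
  coef 2 * z ^+ 2 <= even_poly_fun k coef z.
Proof.
move=> k1; rewrite /even_poly_fun big_ltn// lerDl big_nat.
by apply: sumr_ge0 => i /andP[i2 ik]; rewrite term_ge0// ik ltnW.
Qed.

End even_polynomial.

Section coordinates3.
Local Set Implicit Arguments.
Local Unset Strict Implicit.

Lemma ord3P (P : 'I_3 -> Prop) : P 0 -> P 1 -> P 2%:R -> forall i, P i.
Proof.
move=> P0 P1 P2 [[|[|[|//]]] i3].
- by rewrite (_ : Ordinal i3 = 0)//; exact: val_inj.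
- by rewrite (_ : Ordinal i3 = 1)//; exact: val_inj.
- by rewrite (_ : Ordinal i3 = 2%:R)//; exact: val_inj.
Qed.

Lemma sum3E (V : nmodType) (F : 'I_3 -> V) :
  \sum_(i < 3) F i = F 0 + F 1 + F 2%:R.
Proof.
rewrite !big_ord_recl big_ord0 addr0 addrA.
by congr (F _ + F _ + F _); exact: val_inj.
Qed.

Lemma vec3E (R : realType) (x y z : R) :
  (vec3 x y z 0 0 = x) * (vec3 x y z 0 1 = y) * (vec3 x y z 0 2%:R = z).
Proof. by rewrite /vec3 !mxE. Qed.

End coordinates3.

Section field.
Local Set Implicit Arguments.
Local Unset Strict Implicit.
Context {R : realType} (a b c lambda : R) (k : nat) (coef : nat -> R).

Local Notation G := (field_G a b c lambda k coef).
Local Notation Rz p := (even_poly_fun k coef (p 0 2%:R)).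
Local Notation dRz p := (even_poly_deriv k coef (p 0 2%:R)).

Lemma field_GE p :
  (G p 0 0 = lambda * p 0 0 + (p 0 1 + (a * p 0 0 + b * p 0 1) * Rz p)) *
  (G p 0 1 = lambda * p 0 1 + (- p 0 0 + (- b * p 0 0 + c * p 0 1) * Rz p)) *
  (G p 0 2%:R = lambda * p 0 2%:R - p 0 2%:R * Rz p).
Proof.
rewrite /field_G /field_F; split; [split|]; do 3?rewrite mxE; rewrite !vec3E//.
by rewrite add0r mulNr.
Qed.

Lemma is_derive_Rz (p v : 'rV[R]_3) :
  is_derive p v (fun q => Rz q) (dRz p * v 0 2%:R).
Proof.
have dc := is_derive_coord p v (2%:R : 'I_3).
rewrite -(@derive_val _ _ _ _ _ _ _ dc).
apply: (@is_derive_comp1 _ _ (fun q : 'rV[R]_3 => q 0 2%:R) (even_poly_fun k coef)).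
  exact: differentiable_coord.
exact: is_derive_even_poly.
Qed.

Lemma C1_on_Rz (A : set 'rV[R]_3) : open A -> C1_on A (fun q => Rz q).
Proof.
move=> oA; apply: (@C1_on_comp1 R _ A (fun q : 'rV[R]_3 => q 0 2%:R)
  (even_poly_fun k coef) (even_poly_deriv k coef)) => //.
- exact: C1_on_coord.
- by move=> x _; exact: is_derive_even_poly.
- by move=> x _; exact: even_poly_deriv_continuous.
Qed.

Lemma C1_field_G : C1_on setT G.
Proof.
apply: C1_on_row; first exact: openT.
have oT : open (setT : set 'rV[R]_3) by exact: openT.
have CZ (r : R) (f : 'rV[R]_3 -> R) : C1_on setT f -> C1_on setT (fun p => r * f p).
  move=> fC.
  exact: (@C1_onM R _ setT (fun=> r) f openT (C1_on_cst _ openT) fC).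
have CL (r s : R) : C1_on setT (fun p : 'rV[R]_3 => (r * p 0 0 + s * p 0 1) * Rz p).
  apply: C1_onM => //; last exact: C1_on_Rz.
  by apply: C1_onD => //; apply: CZ; exact: C1_on_coord.
apply: ord3P.
- rewrite (_ : (fun _ => _) = fun p : 'rV[R]_3 =>
    lambda * p 0 0 + (p 0 1 + (a * p 0 0 + b * p 0 1) * Rz p)); last first.
    by apply/funext => p; rewrite field_GE.
  apply: C1_onD => //; first by apply: CZ; exact: C1_on_coord.
  by apply: C1_onD => //; exact: C1_on_coord.
- rewrite (_ : (fun _ => _) = fun p : 'rV[R]_3 =>
    lambda * p 0 1 + (-1 * p 0 0 + (- b * p 0 0 + c * p 0 1) * Rz p)); last first.
    by apply/funext => p; rewrite field_GE mulN1r.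
  apply: C1_onD => //; first by apply: CZ; exact: C1_on_coord.
  by apply: C1_onD => //; apply: CZ; exact: C1_on_coord.
- rewrite (_ : (fun _ => _) = fun p : 'rV[R]_3 =>
    lambda * p 0 2%:R + -1 * (p 0 2%:R * Rz p)); last first.
    by apply/funext => p; rewrite field_GE mulN1r.
  apply: C1_onD => //; first by apply: CZ; exact: C1_on_coord.
  by apply: CZ; apply: C1_onM => //; [exact: C1_on_coord|exact: C1_on_Rz].
Qed.

Lemma field_G0 : G 0 = 0.
Proof.
by apply/rowP; apply: ord3P; rewrite !field_GE !mxE; ring.
Qed.

Lemma derive_field_G (p v : 'rV[R]_3) :
  ('D_v (fun q => G q 0 0) p = lambda * v 0 0 + (v 0 1 +
     ((a * v 0 0 + b * v 0 1) * Rz p +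
      (a * p 0 0 + b * p 0 1) * (dRz p * v 0 2%:R)))) *
  ('D_v (fun q => G q 0 1) p = lambda * v 0 1 + (- v 0 0 +
     ((- b * v 0 0 + c * v 0 1) * Rz p +
      (- b * p 0 0 + c * p 0 1) * (dRz p * v 0 2%:R)))) *
  ('D_v (fun q => G q 0 2%:R) p = lambda * v 0 2%:R -
     (v 0 2%:R * Rz p + p 0 2%:R * (dRz p * v 0 2%:R))).
Proof.
have dv (f : 'rV[R]_3 -> R) df : is_derive p v f df -> 'D_v f p = df.
  by move=> ?; exact: derive_val.
(* the rules below are instances of the class [is_derive]: resolution composes
   them along the expression of each component *)
have dx i := is_derive_coord p v (i : 'I_3).
have dR := is_derive_Rz p v.
have dZ (r : R) f df : is_derive p v f df ->
    is_derive p v (fun q => r * f q) (r * df).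
  by move=> ?; exact: (@is_deriveZ R 'rV[R]_3 R f r p v df).
have dD (f g : 'rV[R]_3 -> R) df dg : is_derive p v f df -> is_derive p v g dg ->
    is_derive p v (fun q => f q + g q) (df + dg).
  by move=> ? ?; exact: is_deriveD.
have dN (f : 'rV[R]_3 -> R) df : is_derive p v f df ->
    is_derive p v (fun q => - f q) (- df).
  by move=> ?; exact: is_deriveN.
have dM (f g : 'rV[R]_3 -> R) df dg : is_derive p v f df -> is_derive p v g dg ->
    is_derive p v (fun q => f q * g q) (df * g p + f p * dg).
  move=> ? ?; apply: (is_derive_eq (is_deriveM _ _)).
  by rewrite -[LHS]/(_ * _ + _ * _) addrC mulrC.
split; [split|].
- rewrite (_ : (fun _ => _) = fun q : 'rV[R]_3 =>
    lambda * q 0 0 + (q 0 1 + (a * q 0 0 + b * q 0 1) * Rz q)); last first.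
    by apply/funext => q; rewrite field_GE.
  by apply: (dv); exact: (dD).
- rewrite (_ : (fun _ => _) = fun q : 'rV[R]_3 =>
    lambda * q 0 1 + (- q 0 0 + (- b * q 0 0 + c * q 0 1) * Rz q)); last first.
    by apply/funext => q; rewrite field_GE.
  by apply: (dv); exact: (dD).
- rewrite (_ : (fun _ => _) = fun q : 'rV[R]_3 =>
    lambda * q 0 2%:R - q 0 2%:R * Rz q); last first.
    by apply/funext => q; rewrite field_GE.
  by apply: (dv); exact: (dD).
Qed.

End field.

(** * Eigenvalues of the Jacobian *)

Section hurwitz_field.
Local Set Implicit Arguments.
Local Unset Strict Implicit.
Context {R : realType} (a b c lambda : R) (k : nat) (coef : nat -> R).

Local Notation G := (field_G a b c lambda k coef).
Local Notation Rz p := (even_poly_fun k coef (p 0 2%:R)).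
Local Notation dRz p := (even_poly_deriv k coef (p 0 2%:R)).

Lemma jacobianE n (f : 'rV[R]_n -> 'rV[R]_n) (p : 'rV[R]_n) i j :
  differentiable f p ->
  jacobian f p i j = 'D_(delta_mx 0 i) (fun q => f q 0 j) p.
Proof.
move=> fp; have := deriveEjacobian (delta_mx 0 i) fp.
rewrite -rowE derive_mx; last exact: diff_derivable.
by move=> /rowP/(_ j); rewrite !mxE.
Qed.

(** Write the eigenvector equation as real equations.  If the third coordinate of
the eigenvector is nonzero, the third equation forces the eigenvalue to be the
negative number lambda - R - z R'.  Otherwise the first two equations, multiplied
by the conjugate coordinates and added, express the real part as a weighted mean
of lambda + a R and lambda + c R: the skew-symmetric terms cancel. *)
Lemma eigenvalue_field_G (p : 'rV[R]_3) (z : R[i]) :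
  c <= a -> a < 0 -> lambda < 0 -> 0 <= Rz p -> 0 <= p 0 2%:R * dRz p ->
  eigenvalue (map_mx (real_complex R) (jacobian G p)) z -> complex.Re z < 0.
Proof.
move=> ca a0 l0 R0 dR0 /eigenvalueP[u uJ u0].
have Gd : differentiable G p by have /(_ p I)[] := C1_field_G a b c lambda k coef.
have uE j : \sum_(i < 3) u 0 i * (jacobian G p i j)%:C%C = z * u 0 j.
  by move/rowP/(_ j) : uJ; rewrite !mxE => <-; apply: eq_bigr => i _; rewrite !mxE.
have := uE 2%:R; have := uE 1; have := uE 0.
rewrite !sum3E !jacobianE// !derive_field_G !mxE/=.
set x := p 0 0; set y := p 0 1; set r := Rz p; set q := p 0 2%:R.
set s := dRz p; have {}R0 : 0 <= r := R0; have {}dR0 : 0 <= q * s := dR0.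
have : (u 0 0 != 0) || (u 0 1 != 0) || (u 0 2%:R != 0).
  apply: contraNT u0; rewrite !negb_or !negbK => /andP[/andP[/eqP e0 /eqP e1] /eqP e2].
  by apply/eqP/rowP; apply: ord3P; rewrite mxE.
case: (u 0 0) => x0 y0; case: (u 0 1) => x1 y1; case: (u 0 2%:R) => x2 y2.
case: z {uJ uE} => zr zi /=.
rewrite !eq_complex /= => u_neq0.
move=> /eqP; rewrite eq_complex /= => /andP[/eqP re0 /eqP im0].
move=> /eqP; rewrite eq_complex /= => /andP[/eqP re1 /eqP im1].
move=> /eqP; rewrite eq_complex /= => /andP[/eqP re2 /eqP im2].
have sq2 (v w : R) : ~~ ((v == 0) && (w == 0)) -> 0 < v ^+ 2 + w ^+ 2.
  move=> vw; rewrite lt_neqAle addr_ge0 ?sqr_ge0// andbT eq_sym.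
  by rewrite paddr_eq0 ?sqr_ge0// !sqrf_eq0.
have [e2|/sq2 N2] := boolP ((x2 == 0) && (y2 == 0)); last first.
  have : (zr - (lambda - r - q * s)) * (x2 ^+ 2 + y2 ^+ 2) = 0.
    transitivity (x2 * (zr * x2 - zi * y2) + y2 * (zr * y2 + zi * x2) -
      (lambda - r - q * s) * (x2 ^+ 2 + y2 ^+ 2)); first by ring.
    by rewrite -re2 -im2; ring.
  move/eqP; rewrite mulf_eq0 (gt_eqF N2) orbF subr_eq0 => /eqP ->.
  lra.
move: u_neq0; rewrite e2 orbF; case/andP: e2 => /eqP x2E /eqP y2E.
rewrite {}x2E {}y2E in re0 im0 re1 im1.
set m := x0 ^+ 2 + y0 ^+ 2; set n := x1 ^+ 2 + y1 ^+ 2 => mn.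
have m0 : 0 <= m by rewrite addr_ge0 ?sqr_ge0.
have n0 : 0 <= n by rewrite addr_ge0 ?sqr_ge0.
have N : 0 < m + n.
  by case/orP: mn => /sq2; rewrite -/m -/n => ?; [rewrite ltr_pwDl|rewrite ltr_wpDl].
(* real part of the Hermitian product of the eigenvector with its image *)
have E : zr * (m + n) = (lambda + a * r) * m + (lambda + c * r) * n.
  transitivity (x0 * (zr * x0 - zi * y0) + y0 * (zr * y0 + zi * x0) +
    x1 * (zr * x1 - zi * y1) + y1 * (zr * y1 + zi * x1)); first by rewrite /m /n; ring.
  by rewrite -re0 -im0 -re1 -im1 /m /n; ring.
rewrite -(pmulr_llt0 _ N) E.
have A : lambda + a * r < 0 by rewrite ltr_wnDr// mulr_le0_ge0// ltW.
have C : lambda + c * r < 0.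
  by rewrite ltr_wnDr// mulr_le0_ge0// (le_trans ca)// ltW.
have [n1|n1] := leP n 0.
  by rewrite ltr_nwDl// ?nmulr_rlt0 ?nmulr_rle0//; lra.
by rewrite ltr_wnDl// ?nmulr_rlt0 ?nmulr_rle0.
Qed.

End hurwitz_field.

(** * Divergence of the density *)

Section density.
Local Set Implicit Arguments.
Local Unset Strict Implicit.
Context {R : realType} (a b c lambda : R) (k : nat) (coef : nat -> R).
Hypothesis hk : (1 <= k)%N.
Hypothesis hcoef : forall i : nat, (1 <= i <= k)%N -> 0 < coef (2 * i)%N.

Local Notation G := (field_G a b c lambda k coef).
Local Notation Rz p := (even_poly_fun k coef (p 0 2%:R)).
Local Notation dRz p := (even_poly_deriv k coef (p 0 2%:R)).

Definition density_base (p : 'rV[R]_3) : R := p 0 0 ^+ 2 + p 0 1 ^+ 2 + Rz p.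

Definition density_coercivity : R := Num.min 1 (coef 2).

Lemma density_coercivity_gt0 : 0 < density_coercivity.
Proof. by rewrite lt_min ltr01 (hcoef (i := 1%N)). Qed.

Lemma density_base_ge (p : 'rV[R]_3) :
  density_coercivity * (p 0 0 ^+ 2 + p 0 1 ^+ 2 + p 0 2%:R ^+ 2) <= density_base p.
Proof.
have H1 : density_coercivity <= 1 by rewrite ge_min lexx.
have H2 : density_coercivity <= coef 2 by rewrite ge_min lexx orbT.
have := even_poly_ge_quadratic hcoef (p 0 2%:R) hk; rewrite /density_base.
have := ler_wpM2r (sqr_ge0 (p 0 0)) H1; have := ler_wpM2r (sqr_ge0 (p 0 1)) H1.
have := ler_wpM2r (sqr_ge0 (p 0 2%:R)) H2; lra.
Qed.

Lemma sumsqr3_gt0 (p : 'rV[R]_3) : p != 0 ->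
  0 < p 0 0 ^+ 2 + p 0 1 ^+ 2 + p 0 2%:R ^+ 2.
Proof.
move=> p0; rewrite lt_neqAle !addr_ge0 ?sqr_ge0// andbT eq_sym.
apply: contra_neq p0 => /eqP.
rewrite !paddr_eq0 ?addr_ge0 ?sqr_ge0// !sqrf_eq0.
move=> /andP[/andP[/eqP e0 /eqP e1] /eqP e2].
by apply/rowP; apply: ord3P; rewrite mxE.
Qed.

Lemma density_base_gt0 (p : 'rV[R]_3) : p != 0 -> 0 < density_base p.
Proof.
move=> p0; apply: lt_le_trans (density_base_ge p).
by rewrite mulr_gt0 ?density_coercivity_gt0 ?sumsqr3_gt0.
Qed.

Lemma is_derive_density_base (p v : 'rV[R]_3) :
  is_derive p v density_base
    (2 * p 0 0 * v 0 0 + 2 * p 0 1 * v 0 1 + dRz p * v 0 2%:R).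
Proof.
have dx i := is_derive_coord p v (i : 'I_3).
have dR := is_derive_Rz k coef p v.
have dX i : is_derive p v (fun q : 'rV[R]_3 => q 0 i ^+ 2) (2 * p 0 i * v 0 i).
  have -> : (fun q : 'rV[R]_3 => q 0 i ^+ 2) = (fun q => q 0 i) * (fun q => q 0 i).
    by apply/funext => q; rewrite expr2.
  by apply: is_derive_eq; rewrite -[LHS]/(_ * _ + _ * _); ring.
have d2 : is_derive p v (fun q : 'rV[R]_3 => q 0 0 ^+ 2 + q 0 1 ^+ 2)
    (2 * p 0 0 * v 0 0 + 2 * p 0 1 * v 0 1) by exact: is_deriveD.
exact: (@is_deriveD R _ _ (fun q : 'rV[R]_3 => q 0 0 ^+ 2 + q 0 1 ^+ 2) (fun q => Rz q)).
Qed.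

Lemma C1_density_base (A : set 'rV[R]_3) : open A -> C1_on A density_base.
Proof.
move=> oA; rewrite (_ : density_base = fun p : 'rV[R]_3 =>
  p 0 0 * p 0 0 + p 0 1 * p 0 1 + Rz p); last first.
  by apply/funext => p; rewrite /density_base !expr2.
apply: C1_onD => //; last exact: C1_on_Rz.
by apply: C1_onD => //; apply: C1_onM => //; exact: C1_on_coord.
Qed.

Lemma open_neq0 : open [set p : 'rV[R]_3 | p != 0].
Proof.
have -> : [set p : 'rV[R]_3 | p != 0] = Num.norm @^-1` [set x : R | 0 < x].
  by apply/seteqP; split => p /=; rewrite normr_gt0.
by apply: open_comp; [move=> p _; exact: norm_continuous|exact: open_gt].
Qed.

Lemma density_rhoE alpha :
  density_rho k coef alpha = fun p => density_base p `^ (- alpha).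
Proof. by []. Qed.

Lemma C1_density_rho alpha : C1_on [set p | p != 0] (density_rho k coef alpha).
Proof.
rewrite density_rhoE.
apply: (@C1_on_comp1 R _ _ density_base (fun r => r `^ (- alpha))
    (fun r => - alpha * r `^ (- alpha - 1))).
- exact: open_neq0.
- exact/C1_density_base/open_neq0.
- by move=> p /density_base_gt0 p0; exact: is_derive1_powR.
- move=> p /density_base_gt0 p0; apply: differentiable_continuous.
  apply/derivable1_diffP; have d := is_derive1_powR (- alpha - 1) p0.
  by apply: derivableM; [exact: derivable_cst|exact: ex_derive].
Qed.

Lemma derive_density_rho alpha (p v : 'rV[R]_3) : p != 0 ->
  'D_v (density_rho k coef alpha) p =
  - alpha * density_base p `^ (- alpha - 1) *
    (2 * p 0 0 * v 0 0 + 2 * p 0 1 * v 0 1 + dRz p * v 0 2%:R).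
Proof.
move=> p0; rewrite density_rhoE.
have [bd _] := C1_density_base openT (I : setT p).
have := is_derive_density_base p v => db.
have d := is_derive1_powR (- alpha) (density_base_gt0 p0).
have := is_derive_comp1 v bd d; rewrite derive_val => dc.
exact: (@derive_val _ _ _ _ _ _ _ dc).
Qed.

(** After factoring out [V^(-alpha - 1)], the first line collects what comes from
lambda I; the rest comes from the nonlinear part, grouped by the factors x^2 and
y^2 and a remainder depending on z only. *)
Lemma div_density_rho alpha (p : 'rV[R]_3) : p != 0 ->
  let x := p 0 0 in let y := p 0 1 in let z := p 0 2%:R in
  let r := Rz p in let zr := z * dRz p in
  div_density (density_rho k coef alpha) G p =
  density_base p `^ (- alpha - 1) *
  (- lambda * ((2 * alpha - 3) * (x ^+ 2 + y ^+ 2) + alpha * zr - 3 * r) +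
   (x ^+ 2 * ((- 2 * alpha * a + a + c - 1) * r - zr) +
    y ^+ 2 * ((- 2 * alpha * c + a + c - 1) * r - zr) +
    r * ((alpha - 1) * zr + (a + c - 1) * r))).
Proof.
move=> p0 /=; rewrite /div_density /divergence /partial !sum3E.
rewrite !derive_density_rho// !derive_field_G !field_GE !mxE/= density_rhoE.
have -> : density_base p `^ (- alpha) = density_base p * density_base p `^ (- alpha - 1).
  rewrite powRB ?(gt_eqF (density_base_gt0 p0)) ?implybT//.
  by rewrite powRr1 ?ltW ?density_base_gt0// mulrC divfK// gt_eqF ?density_base_gt0.
rewrite /density_base; set w := _ `^ _; ring.
Qed.

(** The upper bound [z R' <= 2 k R] makes the coefficients of x^2 and y^2
nonnegative when [alpha > (a + c - 1 - 2 k) / (2 a)]; the lower bound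
[z R' >= 2 R] does the same for the z-part when [alpha > (3 - a - c) / 2], and
bounds the lambda-part below by [- lambda (2 alpha - 3) V], which is positive. *)
Lemma div_density_rho_gt0 alpha (p : 'rV[R]_3) :
  c <= a -> a < 0 -> lambda < 0 -> 2 < alpha ->
  (a + c - 1 - 2 * k%:R) / (2 * a) < alpha -> (3 - a - c) / 2 < alpha ->
  p != 0 -> 0 < div_density (density_rho k coef alpha) G p.
Proof.
move=> ca a0 l0 al2 al_a al_c p0; rewrite div_density_rho//.
rewrite mulr_gt0 ?powR_gt0 ?density_base_gt0//.
have := even_poly_ge0 hcoef (p 0 2%:R).
have := even_poly_euler_ge hcoef (p 0 2%:R).
have := even_poly_euler_le hcoef (p 0 2%:R).
have base0 := density_base_gt0 p0; rewrite /density_base in base0.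
set r := even_poly_fun _ _ _ in base0 *; set zr := _ * dRz p.
move=> zr_le zr_ge r0.
have x0 := sqr_ge0 (p 0 0); have y0 := sqr_ge0 (p 0 1).
set x := p 0 0 ^+ 2 in base0 x0 *; set y := p 0 1 ^+ 2 in base0 y0 *.
apply: ltr_pwDl; last (apply: addr_ge0; first apply: addr_ge0).
- rewrite mulr_gt0 ?oppr_gt0//.
  have : (2 * alpha - 3) * (x + y + r) <=
     (2 * alpha - 3) * (x + y) + alpha * zr - 3 * r by nra.
  by apply: lt_le_trans; rewrite mulr_gt0//; lra.
- (* dividing by [2 * a < 0] reverses the hypothesis on [alpha] *)
  have ca' : 2 * k%:R <= - 2 * alpha * a + a + c - 1.
    move: al_a; rewrite ltr_ndivrMr; last lra.
    lra.
  apply: mulr_ge0 => //; nra.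
- (* [c <= a] only improves the previous bound, since [alpha > 0] *)
  have ca' : 2 * k%:R <= - 2 * alpha * c + a + c - 1.
    move: al_a; rewrite ltr_ndivrMr; last lra.
    nra.
  apply: mulr_ge0 => //; nra.
- apply: mulr_ge0 => //; nra.
Qed.

End density.

(** * Integrability of the density *)

Section integrability.
Local Set Implicit Arguments.
Local Unset Strict Implicit.

Lemma integrable_prod d1 d2 (T1 : measurableType d1) (T2 : measurableType d2)
    (R : realType) (m1 : {sigma_finite_measure set T1 -> \bar R})
    (m2 : {sigma_finite_measure set T2 -> \bar R}) (f : T1 -> R) (g : T2 -> R) :
  m1.-integrable setT (EFin \o f) -> m2.-integrable setT (EFin \o g) ->
  (m1 \x m2)%E.-integrable setT (fun p => (f p.1 * g p.2)%:E).
Proof.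
move=> fi gi.
have mf : measurable_fun setT f by apply/measurable_EFinP; exact: measurable_int fi.
have mg : measurable_fun setT g by apply/measurable_EFinP; exact: measurable_int gi.
have [_ fo] := integrableP _ _ _ fi; have [_ go] := integrableP _ _ _ gi.
apply/integrable12ltyP.
  apply/measurable_EFinP; apply: measurable_funM.
    exact: measurableT_comp.
  exact: measurableT_comp.
under eq_integral => x _.
  under eq_integral => y _ do rewrite /= normrM EFinM.
  rewrite ge0_integralZl//; last exact/measurable_EFinP/measurableT_comp.
  rewrite muleC; over.
rewrite /= ge0_integralZl//; last 2 first.
- exact/measurable_EFinP/measurableT_comp.
- exact: integral_ge0.
rewrite lte_mul_pinfty//.
- exact: integral_ge0.
- by rewrite ge0_fin_numE// integral_ge0.
Qed.

(** Product measures iterate only if the product of two sigma-finite measures is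
again sigma-finite. *)
Lemma sigma_finite_product d1 d2 (T1 : measurableType d1)
    (T2 : measurableType d2) (R : realType)
    (m1 : {sigma_finite_measure set T1 -> \bar R})
    (m2 : {sigma_finite_measure set T2 -> \bar R}) :
  sigma_finite setT (m1 \x m2)%E.
Proof.
have /sigma_finiteP[A [TA ndA Afin]] := sigma_finiteT m1.
have /sigma_finiteP[B [TB ndB Bfin]] := sigma_finiteT m2.
exists (fun n => A n `*` B n).
- apply/seteqP; split => // -[x y] _.
  have [i _ Ax] : (\bigcup_i A i) x by rewrite -TA.
  have [j _ By] : (\bigcup_i B i) y by rewrite -TB.
  exists (maxn i j) => //; split.
  + by have /subsetPset := ndA _ _ (leq_maxl i j); exact.
  + by have /subsetPset := ndB _ _ (leq_maxr i j); exact.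
- move=> n; have [mA fA] := Afin n; have [mB fB] := Bfin n.
  split; first exact: measurableX.
  rewrite product_measure1E// -ge0_fin_numE ?mule_ge0//.
  by rewrite fin_numM// ge0_fin_numE.
Qed.

Context {R : realType}.
Local Notation mu := (@lebesgue_measure R).

Lemma integrable_oneDsqrV : mu.-integrable setT (EFin \o (fun x => (oneDsqr x)^-1)).
Proof.
have mo : measurable_fun setT (fun x : R => (oneDsqr x)^-1).
  by apply: continuous_measurable_fun; exact: continuous_oneDsqrV.
have o0 (x : R) : 0 <= (oneDsqr x)^-1 by rewrite invr_ge0 addr_ge0 ?sqr_ge0.
apply/integrableP; split; first exact/measurable_EFinP.
under eq_integral => x _ do rewrite /= ger0_norm//.
rewrite ge0_symfun_integralT//; last 2 first.
- exact: continuous_oneDsqrV.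
- by move=> x; rewrite /= /oneDsqr sqrrN.
rewrite -set_itvcy integral0y_oneDsqr.
by rewrite -EFinM ltry.
Qed.

(** The area measure under a name of its own, to which the proof of
sigma-finiteness can be attached; [lebesgue3] unfolds to its product with the
length measure. *)
Definition lebesgue2 : set (measurableTypeR R * measurableTypeR R) -> \bar R :=
  (mu \x mu)%E.

HB.instance Definition _ := Measure.on lebesgue2.
HB.instance Definition _ := Measure_isSigmaFinite.Build _ _ _ lebesgue2
  (sigma_finite_product mu mu).

Lemma integrable_oneDsqrV3 : (@lebesgue3 R).-integrable setT (fun p =>
  ((oneDsqr p.1.1)^-1 * (oneDsqr p.1.2)^-1 * (oneDsqr p.2)^-1)%:E).
Proof.
have i2 := integrable_prod integrable_oneDsqrV integrable_oneDsqrV.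
exact: (@integrable_prod _ _ _ _ R lebesgue2 mu
  (fun q => (oneDsqr q.1)^-1 * (oneDsqr q.2)^-1) (fun x => (oneDsqr x)^-1)
  i2 integrable_oneDsqrV).
Qed.

Lemma oneDsqr3_le (x y z : R) :
  oneDsqr x * oneDsqr y * oneDsqr z <= (1 + (x ^+ 2 + y ^+ 2 + z ^+ 2)) ^+ 3.
Proof.
rewrite exprS expr2 mulrA.
have x0 := sqr_ge0 x; have y0 := sqr_ge0 y; have z0 := sqr_ge0 z.
have o0 (t : R) : 0 <= oneDsqr t by rewrite (le_trans ler01)// oneDsqr_ge1.
apply: ler_pM; rewrite ?mulr_ge0//; last by rewrite /oneDsqr; lra.
by apply: ler_pM; rewrite // /oneDsqr; lra.
Qed.

End integrability.

Section density_integrable.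
Local Set Implicit Arguments.
Local Unset Strict Implicit.
Context {R : realType} (k : nat) (coef : nat -> R).
Hypothesis hk : (1 <= k)%N.
Hypothesis hcoef : forall i : nat, (1 <= i <= k)%N -> 0 < coef (2 * i)%N.

(** On the exterior of the unit ball |p|^2 >= (1 + |p|^2) / 2, which turns the lower
bound [density_base_ge] into a lower bound by a multiple of 1 + |p|^2. *)
Lemma density_rho_le alpha (x y z : R) : 3 <= alpha ->
  1 <= x ^+ 2 + y ^+ 2 + z ^+ 2 ->
  density_rho k coef alpha (vec3 x y z) <=
  (density_coercivity coef / 2) `^ (- alpha) *
    ((oneDsqr x)^-1 * (oneDsqr y)^-1 * (oneDsqr z)^-1).
Proof.
move=> al3 s1; set s := _ + z ^+ 2 in s1 *; set e := density_coercivity coef / 2.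
have e0 : 0 < e by rewrite divr_gt0// (density_coercivity_gt0 hk).
have s10 : 0 < 1 + s by lra.
have es : 0 < e * (1 + s) by rewrite mulr_gt0.
have Vge : e * (1 + s) <= density_base k coef (vec3 x y z).
  have := density_base_ge hk hcoef (vec3 x y z); rewrite !vec3E -/s.
  by apply: le_trans; rewrite -mulrA ler_pM2l ?(density_coercivity_gt0 hk)//; lra.
rewrite density_rhoE powRN.
apply: (@le_trans _ _ ((e * (1 + s)) `^ (- alpha))).
  rewrite powRN lef_pV2 ?posrE ?powR_gt0 ?(lt_le_trans es)//.
  by rewrite ge0_ler_powR ?nnegrE ?(ltW es) ?(le_trans _ al3)// (le_trans (ltW es)).
rewrite (powRM _ (ltW e0) (ltW s10)) ler_pM2l ?powR_gt0// powRN -!invfM.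
have o0 (t : R) : 0 < oneDsqr t by rewrite (lt_le_trans ltr01)// oneDsqr_ge1.
rewrite lef_pV2 ?posrE ?mulr_gt0 ?powR_gt0//.
apply: le_trans (oneDsqr3_le _ _ _) _; rewrite -/s -(powR_mulrn _ (ltW s10)).
by rewrite ler_powR// lerDl; lra.
Qed.

Local Notation space := (measurableTypeR R * measurableTypeR R * measurableTypeR R)%type.

Lemma measurable_coords : [/\ measurable_fun setT (fun p : space => p.1.1 : R),
  measurable_fun setT (fun p : space => p.1.2 : R) &
  measurable_fun setT (fun p : space => p.2 : R)].
Proof.
split; last exact: measurable_snd.
- exact: (measurableT_comp measurable_fst measurable_fst).
- exact: (measurableT_comp measurable_snd measurable_fst).
Qed.

Lemma measurable_density_base : measurable_fun setT
  (fun p : space => density_base k coef (of_triple p) : R).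
Proof.
have [m1 m2 m3] := measurable_coords.
rewrite (_ : (fun _ => _) =
    fun p => p.1.1 ^+ 2 + p.1.2 ^+ 2 + (even_poly k coef).[p.2]).
  apply: measurable_funD; first by apply: measurable_funD; exact: measurable_funX.
  apply: measurableT_comp m3; apply: continuous_measurable_fun.
  exact: continuous_horner.
by apply/funext => p; rewrite /density_base /of_triple !vec3E even_polyE.
Qed.

Lemma measurable_outside_ball (r : R) :
  measurable [set p : space | r <= euclid (of_triple p)].
Proof.
have [m1 m2 m3] := measurable_coords.
have me : measurable_fun setT (fun p : space => euclid (of_triple p) : R).
  rewrite (_ : (fun _ => _) =
      fun p => Num.sqrt (p.1.1 ^+ 2 + p.1.2 ^+ 2 + p.2 ^+ 2)).
    apply: measurableT_comp.
      by apply: continuous_measurable_fun; exact: sqrt_continuous.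
    by do 2?apply: measurable_funD; exact: measurable_funX.
  by apply/funext => p; rewrite /euclid sum3E /of_triple !vec3E.
rewrite -[X in measurable X]setTI.
rewrite (_ : [set p | _] =
    (fun p : space => euclid (of_triple p)) @^-1` `[r, +oo[%classic).
  by apply: me.
by apply/seteqP; split => p /=; rewrite in_itv/= andbT.
Qed.

Lemma density_rho_integrable alpha : 3 <= alpha ->
  (@lebesgue3 R).-integrable [set p | 1 <= euclid (of_triple p)]
    (fun p => (density_rho k coef alpha (of_triple p))%:E).
Proof.
move=> al3; pose C := (density_coercivity coef / 2) `^ (- alpha).
have mD := measurable_outside_ball 1.
apply: (@le_integrable _ _ _ _ _ mD _ (fun p => C%:E *
  ((oneDsqr p.1.1)^-1 * (oneDsqr p.1.2)^-1 * (oneDsqr p.2)^-1)%:E)%E).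
- apply/measurable_EFinP; apply: measurable_funTS; rewrite density_rhoE.
  exact: (measurableT_comp (measurable_powR _) measurable_density_base).
- move=> p /= pD.
  have o0 (t : R) : 0 <= (oneDsqr t)^-1.
    by rewrite invr_ge0 (le_trans ler01)// oneDsqr_ge1.
  rewrite !ger0_norm ?powR_ge0 ?mulr_ge0 ?powR_ge0// lee_fin.
  apply: density_rho_le => //.
  move: pD; rewrite /euclid sum3E /of_triple !vec3E.
  rewrite -[X in X <= _]sqrtr1 ler_psqrt ?nnegrE ?ler01//.
  by rewrite !addr_ge0 ?sqr_ge0.
- apply: integrableZl => //.
  exact: (integrableS measurableT _ _ integrable_oneDsqrV3).
Qed.

Lemma ae_neq0 : {ae @lebesgue3 R, forall p, of_triple p != 0}.
Proof.
have m0 : measurable ([set (0 : R)] : set (measurableTypeR R)) by exact: measurable_set1.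
have m2 : measurable ([set (0 : R)] `*` [set (0 : R)] :
    set (measurableTypeR R * measurableTypeR R)) by exact: measurableX.
exists ([set (0 : R)] `*` [set (0 : R)] `*` [set (0 : R)]); split.
- exact: measurableX.
- by rewrite /lebesgue3 /= product_measure1E//= lebesgue_measure_set1 mule0.
- move=> [[x y] z] /= /negP; rewrite negbK => /eqP/rowP p0.
  have := p0 0; have := p0 1; have := p0 2%:R; rewrite /of_triple !vec3E !mxE/=.
  by move=> -> -> ->.
Qed.

End density_integrable.

(** * Dissipativity of the field, and conclusion *)

Lemma field_G_dissipative (R : realType) (a b c lambda : R) (k : nat)
    (coef : nat -> R) (q : 'rV[R]_3) :
  c <= a -> a < 0 -> 0 <= even_poly_fun k coef (q 0 2%:R) ->
  dotr q (field_G a b c lambda k coef q) <= lambda * dotr q q.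
Proof.
move=> ca a0 r0; rewrite /dotr !sum3E !field_GE.
set x := q 0 0; set y := q 0 1; set z := q 0 2%:R; set r := even_poly_fun _ _ _ in r0 *.
have : r * (- a * x ^+ 2 + - c * y ^+ 2 + z ^+ 2) >= 0.
  have na : 0 <= - a by rewrite oppr_ge0 ltW.
  have nc : 0 <= - c by rewrite oppr_ge0 (le_trans ca)// ltW.
  have := mulr_ge0 na (sqr_ge0 x); have := mulr_ge0 nc (sqr_ge0 y).
  by have := sqr_ge0 z => ? ? ?; apply: mulr_ge0 => //; lra.
lra.
Qed.

Theorem proposition3p9 (R : realType) (a b c : R) (k : nat) (coef : nat -> R)
    (lambda : R)
    (hca : c <= a) (ha : a < 0) (hk : (1 <= k)%N)
    (hcoef : forall i : nat, (1 <= i <= k)%N -> 0 < coef (2 * i)%N)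
    (hlambda : lambda < 0) :
  [/\ hurwitz (field_G a b c lambda k coef),
      forall alpha : R,
        Num.max 2 (Num.max ((a + c - 1 - 2 * k%:R) / (2 * a))
                           ((3 - a - c) / 2)) < alpha ->
        3 < alpha ->
        is_density (field_G a b c lambda k coef) (density_rho k coef alpha)
    & globally_asymptotically_stable (field_G a b c lambda k coef)].
Proof.
have GC1 := C1_field_G a b c lambda k coef.
have G0 := field_G0 a b c lambda k coef.
split.
- split; first by split.
  move=> p z; apply: eigenvalue_field_G => //; first exact: even_poly_ge0.
  apply: le_trans (even_poly_euler_ge hcoef _).
  by rewrite mulr_ge0// even_poly_ge0.
- move=> alpha; rewrite !gt_max => /and3P[al2 al_a al_c] al3; split.
  + by split.
  + exact: C1_density_rho.
  + by move=> p _; exact: powR_ge0.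
  + by exists 1 => //; apply: density_rho_integrable => //; exact: ltW.
  + have [N [mN N0 nullN]] := @ae_neq0 R; exists N; split=> // p /= np.
    by apply: nullN => /= p0; apply: np; exact: div_density_rho_gt0.
- apply: (dissipative_stable GC1 G0 hlambda) => q.
  by apply: field_G_dissipative => //; exact: even_poly_ge0.
Qed.
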